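(* Consider the totally quantized gossip algorithm with probabilistic quantizer $q_p$: at each time $t$, when the edge $(i,j)$ is selected, $$x_i(t+1)= \tfrac12 q_p(x_i(t))+\tfrac12 q_p(x_j(t)),\qquad x_j(t+1)= \tfrac12 q_p(x_j(t))+\tfrac12 q_p(x_i(t)),$$ where the same realizations of $q_p(x_i(t))$ and $q_p(x_j(t))$ are used in both equations, and $x_h(t+1)=x_h(t)$ for $h\ne i,j$, starting from a given $x(0)\in\mathbb{R}^N$. Then almost surely there exist $T_{\mathrm{con}}\in\mathbb{Z}_{\ge0}$ and $\alpha\in\mathbb{Z}$ such that $x_i(t)=\alpha$ for all $i\in\mathcal{V}$ and for all $t\ge T_{\mathrm{con}}$.
   Context: Let $\mathcal{G}=(\mathcal{V},\mathcal{E})$ be an undirected connected graph with node set $\mathcal{V}=\{1,\dots,N\}$, whose edges join distinct nodes. At each time $t\in\mathbb{Z}_{\ge0}$ one edge $(i,j)\in\mathcal{E}$ is randomly selected, with probability $W^{(i,j)}>0$, where $\sum_{(i,j)\in\mathcal{E}}W^{(i,j)}=1$. Selections at different times are independent, and the edge selected at time $t$ is independent of $x(t)$ and of the quantization randomness. The probabilistic quantizer: for $x\in\mathbb{R}$, $q_p(x)$ is the random integer equal to $\lfloor x\rfloor$ with probability $\lceil x\rceil-x$ and to $\lceil x\rceil$ with probability $x-\lfloor x\rfloor$ (and $q_p(x)=x$ if $x\in\mathbb{Z}$). Standing independence assumption: for all $t\ge0$, given the values $x_i(t)$ for all $i\in\mathcal{V}$ (and the past), the random variables $q_p(x_i(t))$,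 as $i$ varies, are independent; moreover, given the value $x_i(t)$ for any $i$, the random variable $q_p(x_i(t))$ is independent of $x_j(t)$ for every $j\ne i$. *)

(* Defs.v *)
From HB Require Import structures.
From mathcomp Require Import all_boot all_order all_algebra.
From mathcomp Require Import all_classical all_reals all_analysis.
Set Implicit Arguments.
Unset Strict Implicit.
Unset Printing Implicit Defensive.
Import Order.TTheory GRing.Theory Num.Theory.
Import numFieldNormedType.Exports.
Local Open Scope classical_set_scope.
Local Open Scope ring_scope.

(* An undirected graph on 'I_N is given by its set of edges, an edge being the
   (unordered) set of its two distinct end points. *)
Definition is_edge_set (N : nat) (E : {set {set 'I_N}}) : Prop :=
  forall f, f \in E -> #|f| = 2%N.

Definition adjacent (N : nat) (E : {set {set 'I_N}}) : rel 'I_N :=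
  fun i j => [set i; j]%SET \in E.

Definition connected_graph (N : nat) (E : {set {set 'I_N}}) : Prop :=
  forall i j, connect (adjacent E) i j.

Definition qp_pmf (R : realType) (x : R) (n : int) : R :=
  if x \is a Num.int then (n == Num.floor x)%:R
  else if n == Num.floor x then (Num.ceil x)%:~R - x
  else if n == Num.ceil x then x - (Num.floor x)%:~R
  else 0.

Section probability_notions.
Context {R : realType} {d : measure_display} {T : measurableType d}.
Variable P : probability T R.

(* V is meant to be countable and discrete, so every subset of V is an event. *)
Definition discrete_rv (V : Type) (Z : T -> V) : Prop :=
  forall v, measurable (Z @^-1` [set v]).

Definition mutually_independent (V : Type) (Z : nat -> T -> V) : Prop :=
  forall (s : seq nat) (B : nat -> set V), uniq s ->
    P [set w | forall t, t \in s -> B t (Z t w)] =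
    (\prod_(t <- s) P (Z t @^-1` B t))%E.

Definition independent_of (V : Type) (Z : T -> V) (F : set (set T)) : Prop :=
  forall (A : set T) (B : set V), F A ->
    P (A `&` Z @^-1` B) = (P A * P (Z @^-1` B))%E.

(* g is a version of the conditional probability P(B | F). *)
Definition is_cond_prob (F : set (set T)) (B : set T) (g : T -> R) : Prop :=
  [/\ forall Y : set R, measurable Y -> F (g @^-1` Y),
      P.-integrable setT (fun w => (g w)%:E) &
      forall A, F A -> P (A `&` B) = (\int[P]_(w in A) (g w)%:E)%E].

(* P(Z_i \in B_i for all i | F) = prod_i P(Z_i \in B_i | F); taking B_i = setT
   for some of the i gives the product rule for subfamilies. *)
Definition cond_independent (I : finType) (V : Type) (F : set (set T))
    (Z : I -> T -> V) : Prop :=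
  forall (B : I -> set V) (g : I -> T -> R),
    (forall i, is_cond_prob F (Z i @^-1` B i) (g i)) ->
    is_cond_prob F [set w | forall i, B i (Z i w)] (fun w => \prod_i g i w).

End probability_notions.

Section gossip.
Context {R : realType} {d : measure_display} {T : measurableType d} {N : nat}.
(* x t i : state of node i at time t;
   e t : edge selected at time t;
   q t i : realization of q_p(x_i(t)). *)
Variables (x : nat -> 'I_N -> T -> R) (e : nat -> T -> {set 'I_N})
  (q : nat -> 'I_N -> T -> int).

(* Everything known at time t before the quantizations and the selection of
   time t: all x(s) with s <= t, all q(s) and e(s) with s < t. *)
Definition past (t : nat) : set (set T) :=
  <<s [set A | (exists s i (Y : set R),
                  [/\ (s <= t)%N, measurable Y & A = x s i @^-1` Y])
            \/ (exists s i (n : int), (s < t)%N /\ A = q s i @^-1` [set n])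
            \/ (exists s (f : {set 'I_N}), (s < t)%N /\ A = e s @^-1` [set f])] >>.

(* Generated jointly by x(t) and the quantizations performed up to time t.
   Later quantizations depend on e(t) through x(t+1), so they cannot occur. *)
Definition state_and_quantization (t : nat) : set (set T) :=
  <<s [set A | (exists i (Y : set R), measurable Y /\ A = x t i @^-1` Y)
            \/ (exists s i (n : int), (s <= t)%N /\ A = q s i @^-1` [set n])] >>.

Definition totally_quantized_gossip (x0 : 'I_N -> R) : Prop :=
  (forall w i, x 0%N i w = x0 i) /\
  (forall w t i j, i != j -> e t w = [set i; j]%SET ->
     [/\ x t.+1 i w = 2^-1 * (q t i w)%:~R + 2^-1 * (q t j w)%:~R,
         x t.+1 j w = 2^-1 * (q t j w)%:~R + 2^-1 * (q t i w)%:~R &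
         forall h, h != i -> h != j -> x t.+1 h w = x t h w]).

Definition random_edge_selection (P : probability T R)
    (E : {set {set 'I_N}}) (W : {set 'I_N} -> R) : Prop :=
  [/\ forall t, discrete_rv (e t) /\ (forall w, e t w \in E),
      forall t f, f \in E -> P (e t @^-1` [set f]) = (W f)%:E,
      mutually_independent P e &
      forall t, independent_of P (e t) (state_and_quantization t)].

(* q t i = q_p(x_i(t)): its conditional law given the past, which contains all
   the x_j(t), is that of q_p at x_i(t), and so depends on x_i(t) only. *)
Definition probabilistic_quantization (P : probability T R) : Prop :=
  [/\ forall t i, discrete_rv (q t i),
      forall t i n, is_cond_prob P (past t) (q t i @^-1` [set n])
                      (fun w => qp_pmf (x t i w) n) &
      forall t, cond_independent P (past t) (q t)].

End gossip.

(* Main.v *)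
(* Only the laws of x(t) at single times matter. Rounding every value down has
   positive probability, and since e(t) is independent of (x(t), q(t)), for each
   state v and edge f there is kappa > 0, independent of t, with
   P(x(t) = v, x(t+1) = v') >= kappa P(x(t) = v), where v' is the state reached
   from v by selecting f and rounding down.
   From a non-consensus state some such step decreases a potential: averaging
   two nodes with different floors decreases the sum of the squared floors
   (counted from a lower bound), and when all floors agree, a step through a
   node with a non-integral value makes it integral.
   Integral consensus is absorbing, so P(x(t) in consensus) is nondecreasing and
   its increments tend to 0; hence P(x(t) = v) -> 0 for every non-consensus v,
   by induction on the potential. Almost surely x(t) stays in a fixed finite set of
   states, so P(x(t) not in consensus) -> 0. *)

Require Import Defs.
From mathcomp Require Import all_boot all_order all_algebra.
From mathcomp Require Import all_classical all_reals all_analysis.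
From mathcomp Require Import measurable_realfun zify lra.
Import Order.TTheory GRing.Theory Num.Theory.
Import numFieldNormedType.Exports.
Local Open Scope classical_set_scope.
Local Open Scope ring_scope.

Set Implicit Arguments.
Unset Strict Implicit.
Unset Printing Implicit Defensive.

(** * Rounded-down steps and the potential *)

Definition consensus (R : realType) (N : nat) (v : 'I_N -> R) : Prop :=
  exists alpha : int, forall i, v i = alpha%:~R.

(** The sum over the edge [f] makes the step symmetric, so no order of the two end points has to be
    chosen. *)
Definition floor_step (R : realType) (N : nat) (f : {set 'I_N})
    (v : 'I_N -> R) (h : 'I_N) : R :=
  if h \in f then 2^-1 * \sum_(k in f) (Num.floor (v k))%:~R else v h.

(** The absolute value yields a natural number; it is the true difference only when [m] bounds the
    floors from below, as is assumed wherever that matters. *)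
Definition height (R : realType) (N : nat) (m : int) (v : 'I_N -> R)
    (h : 'I_N) : nat :=
  `|Num.floor (v h) - m|%N.

(* Lexicographic order on the pair (sum of squared heights, number of
   non-integral values), the second component being at most N. *)
Definition potential (R : realType) (N : nat) (m : int) (v : 'I_N -> R) : nat :=
  ((\sum_h height m v h ^ 2) * N.+1 +
   #|[set h | v h \isn't a Num.int]%SET|)%N.

(** * Some edge decreases the potential *)

Section reachability.
Context {R : realType} {N : nat} (E : {set {set 'I_N}}).
Hypotheses (hE : is_edge_set E) (hconn : connected_graph E).

Lemma sum_pair (V : nmodType) (i j : 'I_N) (F : 'I_N -> V) :
  i != j -> \sum_(k in [set i; j]%SET) F k = F i + F j.
Proof.
by move=> ij; rewrite big_setU1 ?inE//= big_set1.
Qed.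

Lemma floor_height (m : int) (v : 'I_N -> R) (h : 'I_N) :
  (m <= Num.floor (v h))%R -> Num.floor (v h) = m + (height m v h)%:Z.
Proof. by rewrite /height => mv; lia. Qed.

(** Write [a + b] as twice its half plus a parity bit: the bit contributes 0 or 1/2 to the average,
    which the floor discards. *)
Lemma floor_half (m : int) (a b : nat) :
  Num.floor (2^-1 * ((m + a%:Z)%:~R + (m + b%:Z)%:~R) : R) =
  m + ((a + b)./2)%:Z.
Proof.
apply: floor_def; rewrite -intrD.
have := odd_double_half (a + b); set c := (_./2) => abE.
have -> : m + a%:Z + (m + b%:Z) = (m + c%:Z) * 2 + (odd (a + b))%:Z by lia.
rewrite [((_ * 2 : int) + _)%:~R]intrD intrM [X in _ < X]intrD.
have : 0 <= (odd (a + b))%:Z%:~R :> R by rewrite ler0n.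
have : (odd (a + b))%:Z%:~R <= 1 :> R by rewrite lern1; case: odd.
lra.
Qed.

Lemma floor_step_pair (m : int) (i j : 'I_N) (v : 'I_N -> R) (h : 'I_N) :
  i != j -> (forall k, (m <= Num.floor (v k))%R) -> h \in [set i; j]%SET ->
  Num.floor (floor_step [set i; j]%SET v h) =
  m + ((height m v i + height m v j)./2)%:Z.
Proof.
move=> ij mv hij; rewrite /floor_step hij sum_pair//.
by rewrite 2?(floor_height (mv _)) floor_half.
Qed.

Lemma floor_step_ge (m : int) (f : {set 'I_N}) (v : 'I_N -> R) :
  f \in E -> (forall k, (m <= Num.floor (v k))%R) ->
  forall k, (m <= Num.floor (floor_step f v k))%R.
Proof.
move=> /hE /eqP /cards2P[i [j [ij ->]]] mv k.
have [kij|kij] := boolP (k \in [set i; j]%SET).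
  by rewrite (floor_step_pair ij mv kij); lia.
by rewrite /floor_step (negbTE kij).
Qed.

Lemma connected_constant (U : Type) (F : 'I_N -> U) :
  (forall i j, Defs.adjacent E i j -> F i = F j) -> forall i j, F i = F j.
Proof.
move=> FE i j; have /connectP[p + ->] := hconn i j.
elim: p i => //= k p IH i /andP[ik kp].
by rewrite (FE _ _ ik) IH.
Qed.

(** An edge provides two distinct nodes, so some node differs from [i] and the path from [i] to it
    has a first edge. *)
Lemma has_neighbour (f : {set 'I_N}) (i : 'I_N) :
  f \in E -> exists j, Defs.adjacent E i j.
Proof.
move=> /hE /eqP /cards2P[a [b [ab _]]].
have [k ki] : exists k, k != i.
  by have [ai|ai] := eqVneq a i; [exists b; rewrite -ai eq_sym|exists a].
have /connectP[[|j p]] := hconn i k.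
  by move=> _ /= ki'; rewrite ki' eqxx in ki.
by move=> /= /andP[ij _] _; exists j.
Qed.

Lemma adjacent_neq (i j : 'I_N) : Defs.adjacent E i j -> i != j.
Proof.
by move=> /hE; rewrite cards2; case: eqVneq.
Qed.

(** If the end points have heights a and b, both get height c = floor((a+b)/2), and 2 c^2 <= (a+b)^2
    / 2 < a^2 + b^2 as soon as a and b differ. *)
Lemma sum_height_step (m : int) (i j : 'I_N) (v : 'I_N -> R) :
  i != j -> (forall k, (m <= Num.floor (v k))%R) ->
  Num.floor (v i) != Num.floor (v j) ->
  (\sum_h height m (floor_step [set i; j]%SET v) h ^ 2 <
   \sum_h height m v h ^ 2)%N.
Proof.
move=> ij mv; rewrite 2!(floor_height (mv _)).
rewrite (bigD1 i)//= (bigD1 j) 1?eq_sym//=.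
rewrite [ltnRHS](bigD1 i)//= [in ltnRHS](bigD1 j) 1?eq_sym//=.
rewrite !addnA; under eq_bigr => h /andP[hi hj].
  rewrite /height /floor_step !inE (negbTE hi) (negbTE hj)/= -/(height m v h).
  over.
rewrite ltn_add2r => hij.
have heightE h : h \in [set i; j]%SET ->
    height m (floor_step [set i; j]%SET v) h =
    ((height m v i + height m v j)./2)%N.
  by move=> hh; rewrite {1}/height (floor_step_pair ij mv hh); lia.
rewrite !heightE ?inE ?eqxx ?orbT//.
move: (height m v i) (height m v j) hij => a b ab.
have := odd_double_half (a + b).
have : a <> b by move=> ab'; rewrite ab' eqxx in ab.
move: (_./2) => c; nia.
Qed.

Lemma potential_decreases (m : int) (f0 : {set 'I_N}) (v : 'I_N -> R) :
  f0 \in E -> (forall k, (m <= Num.floor (v k))%R) -> ~ consensus v ->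
  exists2 f, f \in E & (potential m (floor_step f v) < potential m v)%N.
Proof.
move=> f0E mv ncv.
have [[i [j [eij fij]]]|flat] := pselect
    (exists i j, Defs.adjacent E i j /\ Num.floor (v i) != Num.floor (v j)).
  exists [set i; j]%SET => //.
  have := sum_height_step (adjacent_neq eij) mv fij.
  rewrite /potential; set S1 := (\sum_h _)%N; set S2 := (\sum_h _)%N => S12.
  (* The count of non-integral values may grow, but stays at most [N]; the weight [N.+1] makes the
     drop of the sum prevail. *)
  have : (#|[set h | floor_step [set i; j] v h \isn't a Num.int]| <= N)%SET%N.
    by rewrite -[leqRHS]card_ord max_card.
  move: (#|_|) (#|_|) => c1 c2 ?; nia.
have fl i j : Num.floor (v i) = Num.floor (v j).
  apply: (@connected_constant _ (fun i => Num.floor (v i))) => {}i {}j eij.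
  by apply/eqP/negPn/negP => ?; apply: flat; exists i, j.
(* Otherwise all values equal the common floor. The edge [f0] only supplies a node at which to read
   it. *)
have [i vi] : exists i, v i \isn't a Num.int.
  apply: contrapT => /forallNP vint; apply: ncv.
  have /eqP/cards2P[a _] := hE f0E.
  exists (Num.floor (v a)) => i; rewrite (fl a i).
  by have /negP/negPn := vint i; rewrite intrEfloor => /eqP ->.
have [j eij] := has_neighbour i f0E.
exists [set i; j]%SET => //; have ij := adjacent_neq eij.
(* Equal floors average to themselves, so the step keeps every height and makes node [i]
   integral. *)
have stepE h : h \in [set i; j]%SET ->
    floor_step [set i; j]%SET v h = (Num.floor (v i))%:~R.
  by move=> hh; rewrite /floor_step hh sum_pair// (fl j i); lra.
rewrite /potential; under eq_bigr => h _.
  have -> : height m (floor_step [set i; j]%SET v) h = height m v h.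
    have [hh|hh] := boolP (h \in [set i; j]%SET).
      by rewrite /height (stepE _ hh) intrKfloor (fl i h).
    by rewrite /height /floor_step (negbTE hh).
  over.
rewrite ltn_add2l; apply: proper_card; apply/properP; split.
  apply/fintype.subsetP => h; rewrite !inE.
  have [hh|hh] := boolP (h \in [set i; j]%SET).
    by rewrite (stepE _ hh) intr_int.
  by rewrite /floor_step (negbTE hh).
exists i; rewrite inE//.
by rewrite stepE ?inE ?eqxx// intr_int.
Qed.

End reachability.

(** * General facts on limits, measurability and almost sure events *)

Lemma nondecreasing_increments_cvg0 (R : realType) (u : R ^nat) (M : R) :
  (forall n, u n <= u n.+1) -> (forall n, u n <= M) ->
  (fun n => u n.+1 - u n) @ \oo --> 0.
Proof.
move=> uS uM.
have cu : cvgn u.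
  apply: nondecreasing_is_cvgn; first exact/nondecreasing_seqP.
  by exists M => _ [n _ <-].
rewrite -(subrr (limn u)); apply: cvgB => //.
by rewrite (_ : (fun n => u n.+1) = [sequence u n.+1]_n)// cvg_shiftS.
Qed.

Lemma measurable_forall (d : measure_display) (T : measurableType d)
    (I : finType) (A : I -> set T) :
  (forall i, measurable (A i)) -> measurable [set w | forall i, A i w].
Proof.
move=> mA; rewrite (_ : [set _ | _] = \bigcap_(i in [set: I]) A i).
  by apply: fin_bigcap_measurable => //; exact: finite_finset.
by apply/seteqP; split=> w /= Aw i => [_|]; exact: Aw.
Qed.

Lemma sigma_algebra_forall (T : pointedType) (G : set (set T)) (I : finType)
    (A : I -> set T) :
  (forall i, <<s G >> (A i)) -> <<s G >> [set w | forall i, A i w].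
Proof. exact: (@measurable_forall _ (g_sigma_algebraType G)). Qed.

Lemma sigma_algebra_setI (T : pointedType) (G : set (set T)) (A B : set T) :
  <<s G >> A -> <<s G >> B -> <<s G >> (A `&` B).
Proof. exact: (@measurableI _ (g_sigma_algebraType G)). Qed.

Lemma discrete_rv_measurable (d : measure_display) (T : measurableType d)
    (V : countType) (Z : T -> V) (B : set V) :
  discrete_rv Z -> measurable (Z @^-1` B).
Proof.
move=> mZ; rewrite (_ : Z @^-1` B =
    \bigcup_v (if v \in B then Z @^-1` [set v] else set0)).
  by apply: countable_bigcupT_measurable => // v; case: ifP.
apply/seteqP; split=> [w BZ|w [v _]].
  by exists (Z w) => //; rewrite mem_set.
by case: ifPn => // /set_mem Bv /= ->.
Qed.

Section almost_sure.
Context {d : measure_display} {T : measurableType d} {R : realType}.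
Variable P : probability T R.

Lemma prE (A : set T) : measurable A -> P A = (fine (P A))%:E.
Proof. by move=> mA; rewrite fineK// fin_num_measure. Qed.

Lemma pr_ge0 (A : set T) : 0 <= fine (P A).
Proof. by rewrite fine_ge0. Qed.

Lemma pr_le1 (A : set T) : measurable A -> fine (P A) <= 1.
Proof. by move=> mA; rewrite -lee_fin -prE// probability_le1. Qed.

Lemma pr_le_ae (A B : set T) : measurable A -> measurable B ->
  {ae P, forall w, A w -> B w} -> fine (P A) <= fine (P B).
Proof.
move=> mA mB [Z [mZ Z0 ABZ]]; rewrite -lee_fin -!prE//.
apply: (@le_trans _ _ (P (B `|` Z))).
  apply: le_measure; rewrite ?inE//; first exact: measurableU.
  move=> w Aw; have [Bw|nBw] := pselect (B w); first by left.
  by right; apply: ABZ => /= /(_ Aw).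
by rewrite -[leRHS]adde0 -Z0; exact: measureU2.
Qed.

Lemma pr_setU (A B : set T) : measurable A -> measurable B ->
  A `&` B = set0 -> fine (P (A `|` B)) = fine (P A) + fine (P B).
Proof.
by move=> mA mB AB; rewrite measureU// fineD// fin_num_measure.
Qed.

Lemma pr_bigsetU (I : finType) (c : pred I) (A : I -> set T) :
  (forall i, measurable (A i)) ->
  fine (P (\big[setU/set0]_(i | c i) A i)) <= \sum_(i | c i) fine (P (A i)).
Proof.
move=> mA.
suff [] : measurable (\big[setU/set0]_(i | c i) A i) /\
  fine (P (\big[setU/set0]_(i | c i) A i)) <=
    \sum_(i | c i) fine (P (A i)) by [].
elim/big_ind2 : _ => [|B b C c' [mB Bb] [mC Cc]|i _]; last by split.
  by rewrite measure0.
split; first exact: measurableU.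
apply: le_trans (lerD Bb Cc).
by rewrite -lee_fin EFinD -!prE ?measureU2//; exact: measurableU.
Qed.

Lemma ae_forall_count (I : countType) (Q : I -> T -> Prop) :
  (forall i, {ae P, forall w, Q i w}) -> {ae P, forall w, forall i, Q i w}.
Proof.
move=> aeQ.
have : {ae P, forall w, forall n, if unpickle n is Some i then Q i w else True}.
  apply: ae_foralln => n; case: unpickle => [i|]; first exact: aeQ.
  by apply: aeW.
by apply: filterS => w Qw i; have := Qw (pickle i); rewrite pickleK.
Qed.

End almost_sure.

(** * The law of the quantizer *)

Lemma qp_pmf_far (R : realType) (y : R) (n : int) :
  1 <= `|n%:~R - y| -> qp_pmf y n = 0.
Proof.
rewrite /qp_pmf ceil_floor intrEfloor => far.
have /andP[] := floor_itv y; rewrite intrD.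
case: eqVneq => [yE _ _|yNint fy yf].
  case: eqVneq => // nE; move: far; rewrite nE yE subrr normr0.
  by rewrite leNgt ltr01.
case: eqVneq => [nE|_].
  by move: far; rewrite nE ler0_norm ?subr_le0//; lra.
case: eqVneq => // nE; move: far; rewrite nE intrD /= ger0_norm; last by lra.
by have := yNint; rewrite neq_lt => /orP[]; lra.
Qed.

Lemma qp_pmf_floor_gt0 (R : realType) (y : R) : 0 < qp_pmf y (Num.floor y).
Proof.
rewrite /qp_pmf eqxx; case: ifPn => // yNint.
have /andP[_] := floor_itv y.
by rewrite ceil_floor yNint subr_gt0.
Qed.

(** * Pathwise dynamics and measurability of the process *)

Section process.
Context {R : realType} {d : measure_display} {T : measurableType d} {N : nat}.
Context {P : probability T R} {E : {set {set 'I_N}}} {W : {set 'I_N} -> R}.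
Context {x0 : 'I_N -> R} {x : nat -> 'I_N -> T -> R}.
Context {e : nat -> T -> {set 'I_N}} {q : nat -> 'I_N -> T -> int}.
Hypotheses (hE : is_edge_set E) (hconn : connected_graph E).
Hypothesis hWpos : forall f, f \in E -> 0 < W f.
Hypothesis hsel : random_edge_selection x e q P E W.
Hypothesis hquant : probabilistic_quantization x e q P.
Hypothesis hdyn : totally_quantized_gossip x e q x0.

Let e_edge t w : e t w \in E.
Proof. by have [/(_ t)[]] := hsel. Qed.

Lemma gossip_update t w h : x t.+1 h w =
  if h \in e t w then 2^-1 * \sum_(k in e t w) (q t k w)%:~R else x t h w.
Proof.
have /eqP/cards2P[i [j [ij eij]]] := hE (e_edge t w).
have [xi xj xh] := hdyn.2 w t i j ij eij.
rewrite eij sum_pair// !inE.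
have [->|hi] := eqVneq h i; first by rewrite xi mulrDr.
have [->|hj] := eqVneq h j; first by rewrite xj addrC mulrDr.
exact: xh.
Qed.

Let mq t i (B : set int) : measurable (q t i @^-1` B).
Proof. by have [+ _ _] := hquant => mq; exact: discrete_rv_measurable. Qed.

Let me t (B : set {set 'I_N}) : measurable (e t @^-1` B).
Proof.
by have [/(_ t)[me _] _ _ _] := hsel; exact: discrete_rv_measurable.
Qed.

Lemma measurable_state t h : measurable_fun setT (x t h).
Proof.
elim: t h => [|t IH] h.
  rewrite (_ : x 0%N h = cst (x0 h)); first exact: measurable_cst.
  by apply/funext => w; rewrite hdyn.1.
have mS f : measurable_fun setT
    (fun w => 2^-1 * \sum_(k <- enum f) (q t k w)%:~R : R).
  apply: measurable_funM; first exact: measurable_cst.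
  apply: measurable_sum => k _ Y mY; rewrite setTI.
  rewrite (_ : _ @^-1` _ = q t k @^-1` [set n | Y n%:~R])//.
move=> _ Y mY; rewrite setTI.
(* Split along the selected edge: on each piece the new value is a fixed half sum of quantizations
   or the old value. *)
rewrite (_ : _ @^-1` _ = \bigcup_f (e t @^-1` [set f] `&`
   if h \in f then (fun w => 2^-1 * \sum_(k <- enum f) (q t k w)%:~R) @^-1` Y
   else x t h @^-1` Y)).
  apply: countable_bigcupT_measurable => // f; apply: measurableI => //.
  by case: ifP => _; rewrite -[_ @^-1` _]setTI; [exact: mS|exact: IH].
apply/seteqP; split=> w /=; rewrite gossip_update.
  move=> Yw; exists (e t w) => //; split => //.
  by case: ifPn Yw; rewrite -?big_enum.
by case=> f _ [/= -> +]; case: ifPn; rewrite -?big_enum.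
Qed.

(** For fixed [t], [i], [n], the probability that [q t i] equals [n] while [x t i] is at distance at
    least 1 from [n] is the integral of a vanishing mass function. There are countably many such
    triples. *)
Lemma quantization_close :
  {ae P, forall w, forall t i, `|(q t i w)%:~R - x t i w| < 1}.
Proof.
apply: ae_forall_count => t; apply: ae_forall_count => i.
suff far n : {ae P, forall w, q t i w = n -> `|n%:~R - x t i w| < 1}.
  have /ae_forall_count : forall n : int,
    {ae P, forall w, q t i w = n -> `|n%:~R - x t i w| < 1} by [].
  by apply: filterS => w; exact.
pose Y : set R := [set y | 1 <= `|n%:~R - y|].
have mY : measurable Y.
  rewrite (_ : Y = (fun y : R => `|n%:~R - y|) @^-1` `[1, +oo[%classic);
    last first.
    by apply/seteqP; split=> y; rewrite /Y/= in_itv/= andbT.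
  rewrite -[_ @^-1` _]setTI.
  have : measurable_fun setT (fun y : R => `|n%:~R - y|).
    by apply: measurableT_comp => //; exact: measurable_funB.
  by apply.
have [_ /(_ t i n)[_ _ cond] _] := hquant.
have pastA : past x e q t (x t i @^-1` Y).
  by apply: sub_sigma_algebra; left; exists t, i, Y.
exists (x t i @^-1` Y `&` q t i @^-1` [set n]); split.
- apply: measurableI => //.
  by rewrite -[_ @^-1` _]setTI; exact: measurable_state.
- rewrite cond//; apply: integral0_eq => w /= far.
  by rewrite qp_pmf_far.
- move=> w /= /not_implyP[qn /negP]; rewrite -leNgt => far.
  by split.
Qed.

(** * Probability of a rounded-down step *)

Definition state_event (t : nat) (v : 'I_N -> R) : set T :=
  [set w | forall i, x t i w = v i].

Definition floored (t : nat) (v : 'I_N -> R) : set T :=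
  [set w | forall i, q t i w = Num.floor (v i)].

(** Conditional probability, given the state [v], that [f] is selected and all nodes, not only the
    end points of [f], round down. It does not depend on the time. *)
Definition floor_weight (f : {set 'I_N}) (v : 'I_N -> R) : R :=
  W f * \prod_i qp_pmf (v i) (Num.floor (v i)).

Lemma floor_weight_gt0 f v : f \in E -> 0 < floor_weight f v.
Proof.
move=> fE; rewrite mulr_gt0 ?hWpos// prodr_gt0// => i _.
exact: qp_pmf_floor_gt0.
Qed.

Lemma measurable_state_event t v : measurable (state_event t v).
Proof.
apply: measurable_forall => i.
rewrite (_ : (fun _ => _) = x t i @^-1` [set v i])// -[_ @^-1` _]setTI.
exact: measurable_state.
Qed.

Lemma measurable_floored t v : measurable (floored t v).
Proof.
by apply: measurable_forall => i; exact: (mq t i [set Num.floor (v i)]).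
Qed.

(** The edge factors out by independence from state and quantizations. The conditional product rule
    then turns the rest into the integral, over the state event, of a function that is constant
    there. *)
Lemma pr_floor_step t f v : f \in E ->
  fine (P (state_event t v `&` floored t v `&` e t @^-1` [set f])) =
  floor_weight f v * fine (P (state_event t v)).
Proof.
move=> fE.
have SQ : state_and_quantization x q t (state_event t v `&` floored t v).
  apply: sigma_algebra_setI; apply: sigma_algebra_forall => i;
    apply: sub_sigma_algebra.
    by left; exists i, [set v i]; split => //; exact: measurable_set1.
  by right; exists t, i, (Num.floor (v i)).
have [_ He _ /(_ t) indep] := hsel.
rewrite indep// He//.
have [_ cq /(_ t) ind] := hquant.
have [_ _ ->] := ind (fun i => [set Num.floor (v i)])
  (fun i w => qp_pmf (x t i w) (Num.floor (v i))) (fun i => cq t i _).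
  rewrite (eq_integral (cst (\prod_i qp_pmf (v i) (Num.floor (v i)))%:E)).
    rewrite integral_cst; last exact: measurable_state_event.
    rewrite [X in (_ * X * _)%E](prE P (measurable_state_event t v)).
    by rewrite -!EFinM /floor_weight /= mulrC mulrA.
  move=> w; rewrite inE => vw /=; congr (_%:E).
  by apply: eq_bigr => i _; rewrite vw.
apply: sigma_algebra_forall => i; apply: sub_sigma_algebra.
by left; exists t, i, [set v i]; split => //; exact: measurable_set1.
Qed.

Lemma floor_step_event t f v w :
  (state_event t v `&` floored t v `&` e t @^-1` [set f]) w ->
  state_event t.+1 (floor_step f v) w.
Proof.
move=> [[vw qw] /= ew] i; rewrite gossip_update ew /floor_step vw.
by case: ifP => // _; congr (_ * _); apply: eq_bigr => k _; rewrite qw.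
Qed.

(** * Consensus is absorbing, other states vanish *)

Let consensus_event t : set T := [set w | consensus (fun i => x t i w)].

Lemma measurable_consensus_event t : measurable (consensus_event t).
Proof.
rewrite (_ : consensus_event t =
    \bigcup_(a : int) state_event t (fun=> a%:~R)).
  by apply: countable_bigcupT_measurable => // a; exact: measurable_state_event.
by apply/seteqP; split=> w [a]; [exists a|exists a].
Qed.

(* An integer is the only integer at distance less than 1 from itself. *)
Lemma consensus_absorbing :
  {ae P, forall w, forall t (a : int),
    state_event t (fun=> a%:~R) w -> state_event t.+1 (fun=> a%:~R) w}.
Proof.
apply: filterS quantization_close => w close t a xa h.
have qa i : q t i w = a.
  have := close t i; rewrite xa -intrB -intr_norm -[1]/(1%:~R) ltr_int; lia.
rewrite gossip_update; case: ifP => // _.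
have /eqP/cards2P[i [j [ij ->]]] := hE (e_edge t w).
by rewrite sum_pair// !qa; lra.
Qed.

(** Being in consensus and stepping from [v] along [f] are disjoint events, since [v] is not a
    consensus, and almost surely both lead to consensus at the next time. *)
Lemma consensus_event_le t f v : f \in E -> ~ consensus v ->
  consensus (floor_step f v) ->
  fine (P (consensus_event t)) + floor_weight f v * fine (P (state_event t v))
    <= fine (P (consensus_event t.+1)).
Proof.
move=> fE ncv cfv.
have mJ : measurable (state_event t v `&` floored t v `&` e t @^-1` [set f]).
  do 2?apply: measurableI => //; first exact: measurable_state_event.
  exact: measurable_floored.
rewrite -pr_floor_step// -pr_setU//; first last.
- rewrite -subset0 => w [[a xa] [[vw _] _]]; apply: ncv.
  by exists a => i; rewrite -vw.
- exact: measurable_consensus_event.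
apply: pr_le_ae.
- by apply: measurableU => //; exact: measurable_consensus_event.
- exact: measurable_consensus_event.
apply: filterS consensus_absorbing => w absorb [[a xa]|].
  by exists a; exact: absorb.
move=> /floor_step_event vw; case: cfv => a va.
by exists a => i; rewrite vw.
Qed.

Lemma consensus_event_homo t :
  fine (P (consensus_event t)) <= fine (P (consensus_event t.+1)).
Proof.
apply: pr_le_ae; [exact: measurable_consensus_event..|].
apply: filterS consensus_absorbing => w absorb [a xa].
by exists a; exact: absorb.
Qed.

Lemma state_event_cvg0 (m : int) (f0 : {set 'I_N}) (v : 'I_N -> R) :
  f0 \in E -> (forall k, m <= Num.floor (v k)) -> ~ consensus v ->
  (fun t => fine (P (state_event t v))) @ \oo --> 0.
Proof.
move=> f0E; have [n] := ubnP (potential m v).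
elim: n v => // n IH v; rewrite ltnS => vn mv ncv.
have [f fE fv] := potential_decreases hE hconn f0E mv ncv.
have kappa0 := floor_weight_gt0 v fE; set kappa := floor_weight f v in kappa0.
(* Since [kappa] is positive and independent of [t], any vanishing bound on the step probability
   suffices. *)
suff [u u0 uP] : exists2 u : R ^nat, u @ \oo --> 0 &
    forall t, kappa * fine (P (state_event t v)) <= u t.
  apply: (@squeeze_cvgr _ _ _ _ (cst 0) (fun t => kappa^-1 * u t)).
  - by near=> t; rewrite pr_ge0/= ler_pdivlMl.
  - exact: cvg_cst.
  - by rewrite -(mulr0 kappa^-1); apply: cvgM => //; exact: cvg_cst.
have [cfv|ncfv] := pselect (consensus (floor_step f v)).
  (* The step enters consensus, so it is paid for by an increment of the consensus probability. *)
  exists (fun t =>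
    fine (P (consensus_event t.+1)) - fine (P (consensus_event t))).
    apply: (@nondecreasing_increments_cvg0 _
      (fun t => fine (P (consensus_event t))) 1) => t.
      exact: consensus_event_homo.
    by rewrite pr_le1//; exact: measurable_consensus_event.
  by move=> t; have := consensus_event_le t fE ncv cfv; rewrite -/kappa; lra.
(* The step leads to a non-consensus state of smaller potential, to which the induction hypothesis
   applies. *)
exists (fun t => fine (P (state_event t.+1 (floor_step f v)))).
  have := IH _ (leq_trans fv vn) (floor_step_ge hE fE mv) ncfv.
  by rewrite -(cvg_shiftS (fun t => fine (P (state_event t (floor_step f v))))).
move=> t; rewrite -pr_floor_step//; apply: pr_le_ae.
- do 2?apply: measurableI => //; first exact: measurable_state_event.
  exact: measurable_floored.
- exact: measurable_state_event.
- by apply: aeW => w; exact: floor_step_event.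
Unshelve. all: by end_near. Qed.

(** * Confinement to a finite set of states *)

Section finite_range.
Variable k : nat.
Hypothesis x0_le : forall i, `|x0 i| <= k%:R.

(** [None] stands for a node that still has its initial value; [Some z] enumerates the half-integers
    from -k to k. *)
Definition grid_value (i : 'I_N) (o : option 'I_(4 * k).+1) : R :=
  if o is Some z then 2^-1 * (z%:Z - (2 * k)%:Z)%:~R else x0 i.

Lemma grid_value_le i o : `|grid_value i o| <= k%:R.
Proof.
case: o => [z|]; last exact: x0_le.
have : (z <= 4 * k)%N by rewrite -ltnS ltn_ord.
rewrite -(ler_nat R) natrM /= => zk; rewrite intrB -!pmulrn natrM ler_norml.
have : 0 <= (z : nat)%:R :> R by [].
lra.
Qed.

Lemma grid_value_half i (n : int) : `|n| <= (2 * k)%:Z ->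
  exists o, grid_value i o = 2^-1 * n%:~R.
Proof.
move=> nk; have zP : (`|(n + (2 * k)%:Z)%R| < (4 * k).+1)%N by lia.
exists (Some (Ordinal zP)); rewrite /grid_value /=; congr (_ * _%:~R); lia.
Qed.

Definition grid_state (c : {ffun 'I_N -> option 'I_(4 * k).+1})
    (i : 'I_N) : R :=
  grid_value i (c i).

Lemma ae_grid_state :
  {ae P, forall w, forall t, exists c, state_event t (grid_state c) w}.
Proof.
apply: filterS quantization_close => w close t.
suff xg : forall i, exists o, x t i w = grid_value i o.
  have [c xc] := all_sig (fun i => cid (xg i)).
  by exists [ffun i => c i] => i; rewrite /grid_state ffunE xc.
elim: t => [|t IH] i; first by exists None; rewrite hdyn.1.
rewrite gossip_update; case: ifP => _; last exact: IH.
have /eqP/cards2P[a [b [ab ->]]] := hE (e_edge t w).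
(* The quantization moves by less than 1 from a value of size at most [k], and an integer of
   absolute value below k + 1 is at most [k] in size. *)
have qk j : `|q t j w| <= k%:Z.
  have [y xy] := IH j; have := grid_value_le j y; rewrite -xy.
  have := close t j.
  rewrite -ltzD1 -(ltr_int R) intr_norm intrD -pmulrn.
  have := ler_normD ((q t j w)%:~R - x t j w) (x t j w).
  by rewrite subrK; lra.
rewrite sum_pair// -intrD.
have [|o <-] := @grid_value_half i (q t a w + q t b w); last by exists o.
have := qk a; have := qk b; lia.
Qed.

Lemma pr_nonconsensus_cvg0 (f0 : {set 'I_N}) : f0 \in E ->
  (fun t => fine (P (~` consensus_event t))) @ \oo --> 0.
Proof.
move=> f0E.
pose u t := \sum_(c | ~~ `[< consensus (grid_state c) >])
  fine (P (state_event t (grid_state c))).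
apply: (@squeeze_cvgr _ _ _ _ (cst 0) u); last 2 first.
- exact: cvg_cst.
- suff : u @ \oo --> \sum_(c | ~~ `[< consensus (grid_state c) >]) (0 : R).
    by rewrite big1_eq.
  apply: cvg_big; first exact: add_continuous.
  (* All grid values are at least -k, so -k is a lower bound for their floors. *)
  move=> c /asboolPn ncc; apply: (@state_event_cvg0 (- k%:Z) f0) => // i.
  rewrite floor_ge_int intrN -pmulrn.
  by have := grid_value_le i (c i); rewrite ler_norml => /andP[].
near=> t; rewrite pr_ge0/=.
apply: le_trans (pr_bigsetU _ _
  (fun c => measurable_state_event t (grid_state c))).
apply: pr_le_ae.
- by apply: measurableC; exact: measurable_consensus_event.
- by apply: bigsetU_measurable => c _; exact: measurable_state_event.
apply: filterS ae_grid_state => w /(_ t)[c xc] nc.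
rewrite (bigD1 c)/=; first by left.
by apply/asboolPn => -[a ca]; apply: nc; exists a => i; rewrite xc.
Unshelve. all: by end_near. Qed.

End finite_range.

(** * Almost sure consensus *)

Lemma ae_consensus :
  {ae P, forall w, exists (Tcon : nat) (alpha : int),
    forall (i : 'I_N) (t : nat), (Tcon <= t)%N -> x t i w = alpha%:~R}.
Proof.
(* The edge selected at time 0, at an arbitrary sample point, shows that the graph has an edge. *)
have [f0 f0E] : exists f0, f0 \in E by exists (e 0%N point).
pose k := (\max_i Num.bound `|x0 i|)%N.
have x0_le i : `|x0 i| <= k%:R.
  apply: ltW (lt_le_trans (archi_boundP (normr_ge0 _)) _).
  by rewrite ler_nat; exact: (leq_bigmax i).
have reached : {ae P, forall w, exists t, consensus_event t w}.
  (* Never reaching consensus is contained in non-consensus at each [t], so its probability is at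
     most the limit 0. *)
  have mB : measurable (\bigcap_t ~` consensus_event t).
    apply: bigcap_measurableType => t _; apply: measurableC.
    exact: measurable_consensus_event.
  exists (\bigcap_t ~` consensus_event t); split => //.
    rewrite prE//; congr (_%:E); apply/eqP; rewrite eq_le pr_ge0 andbT.
    have cvg0 := pr_nonconsensus_cvg0 x0_le f0E.
    rewrite -(cvg_lim _ cvg0)//; apply: limr_ge; first exact: cvgP cvg0.
    near=> t; apply: pr_le_ae => //.
      by apply: measurableC; exact: measurable_consensus_event.
    by apply: aeW => w /(_ t); exact.
  by move=> w /= /forallNP nc t _; exact: nc.
apply: filterS2 consensus_absorbing reached => w absorb [t0 [a xa]].
exists t0, a => i t /subnK <-; elim: (t - t0)%N i => [|s IH] i; first exact: xa.
exact: absorb.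
Unshelve. all: by end_near. Qed.

End process.

Theorem corollary4p4 (R : realType) (d : measure_display)
    (T : measurableType d) (P : probability T R)
    (N : nat) (E : {set {set 'I_N}}) (W : {set 'I_N} -> R)
    (x0 : 'I_N -> R) (x : nat -> 'I_N -> T -> R)
    (e : nat -> T -> {set 'I_N}) (q : nat -> 'I_N -> T -> int)
    (hE : is_edge_set E) (hconn : connected_graph E)
    (hWpos : forall f, f \in E -> 0 < W f)
    (hWsum : \sum_(f in E) W f = 1)
    (hsel : random_edge_selection x e q P E W)
    (hquant : probabilistic_quantization x e q P)
    (hdyn : totally_quantized_gossip x e q x0) :
  {ae P, forall w, exists (Tcon : nat) (alpha : int),
    forall (i : 'I_N) (t : nat), (Tcon <= t)%N -> x t i w = alpha%:~R}.
Proof. exact: (ae_consensus hE hconn hWpos hsel hquant hdyn). Qed.
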